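(* Let $X$ be a finite CW complex with oriented cells and $d\ge1$. Let $\pi_d:Z_d(X;\mathbb R)\to\mathcal H_d$ be the orthogonal projection onto the space of $d$-dimensional harmonics. Then $\pi_d(Z_d(X;\mathbb Z))$ is a lattice in $\mathcal H_d$ and $$\operatorname{covol}^2\big(\pi_d(Z_d(X;\mathbb Z))\big)=\frac{\operatorname{covol}^2\big(Z_d(X;\mathbb Z)\big)}{\operatorname{covol}^2\big(B_d(X;\mathbb Z)\big)}\cdot t_d(X)^2 ,$$ where $t_d(X)$ is the order of the torsion subgroup of $H_d(X;\mathbb Z)$.
   Context: $C_d$, $Z_d$, $B_d$ are cellular chains, cycles, boundaries. $C_d(X;\mathbb R)$ carries the inner product $\langle\cdot,\cdot\rangle$ for which the oriented $d$-cells are orthonormal; $\partial_{d+1}^\star$ is the adjoint of $\partial_{d+1}:C_{d+1}(X;\mathbb R)\to C_d(X;\mathbb R)$ for these inner products. $\mathcal H_d=\{c\in C_d(X;\mathbb R)\mid\partial_d c=0,\ \partial_{d+1}^\star c=0\}$, so that $Z_d(X;\mathbb R)=\mathcal H_d\oplus B_d(X;\mathbb R)$ orthogonally. For a finitely generated discrete subgroup $\Lambda\subset C_d(X;\mathbb R)$ with $\mathbb Z$-basis $\{\lambda_i\}$, the covolume squared is the Gram determinant $\operatorname{covol}^2(\Lambda)=\det(\langle\lambda_i,\lambda_j\rangle)$ (equal to $1$ if $\Lambda=0$); for $\Lambda=Z_d(X;\mathbb Z)$ and $\Lambda=B_d(X;\mathbb Z)$ these are the determinants of the mesh matrices on $d$-cycles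 and $d$-boundaries. *)

(* Defs.v *)
From HB Require Import structures.
From mathcomp Require Import all_boot all_order all_algebra.
From mathcomp Require Import finmap.
From mathcomp Require Import all_classical all_reals.
From mathcomp Require Import topology normedtype.
From mathcomp Require Import freeg.

Set Implicit Arguments.
Unset Strict Implicit.
Unset Printing Implicit Defensive.

Import Order.TTheory GRing.Theory Num.Theory.
Import numFieldNormedType.Exports.
Local Open Scope classical_set_scope.
Local Open Scope ring_scope.

Definition is_subgroup (V : zmodType) (L : set V) : Prop :=
  L 0 /\ forall x y, L x -> L y -> L (x - y).

Definition zspan (V : zmodType) (S : set V) : set V := smallest (@is_subgroup V) S.

Section Euclidean.
Variables (R : realType) (n : nat).
Implicit Types (u v : 'rV[R]_n) (L V : set 'rV[R]_n).

Definition dot u v : R := \sum_(i < n) u 0 i * v 0 i.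

Definition orthproj V v : 'rV[R]_n :=
  xget 0 [set h | V h /\ forall w, V w -> dot (v - h) w = 0].

Definition linspan L : set 'rV[R]_n :=
  [set v | exists r (a : 'rV[R]_r) (b : 'M[R]_(r, n)),
     (forall i, L (row i b)) /\ v = a *m b].

Definition discrete_set L : Prop := L `<=` isolated L.

Definition is_lattice V L : Prop :=
  [/\ L `<=` V, is_subgroup L, discrete_set L & V `<=` linspan L].

(* The rows of b form a Z-basis of L. *)
Definition is_Zbasis L r (b : 'M[R]_(r, n)) : Prop :=
  set_bij [set: 'rV[int]_r] L (fun c => map_mx intr c *m b).

Definition gram r (b : 'M[R]_(r, n)) : 'M[R]_r :=
  \matrix_(i, j) dot (row i b) (row j b).

(* The Gram determinant of a Z-basis of L does not depend on the basis, so
   that the choice made by xget is immaterial; 0 is the value when L has no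
   Z-basis. *)
Definition covol2 L : R :=
  xget 0 [set x | exists r (b : 'M[R]_(r, n)), is_Zbasis L b /\ x = \det (gram b)].

End Euclidean.

(* Matrices act on row vectors from the right; for the standard inner products
   the adjoint of c |-> c *m A is the following map. *)
Definition adjoint (R : realType) m n (A : 'M[R]_(m, n)) (c : 'rV[R]_n) : 'rV[R]_m :=
  c *m A^T.

Lemma adjointP (R : realType) m n (A : 'M[R]_(m, n)) (u : 'rV[R]_m) (v : 'rV[R]_n) :
  dot (u *m A) v = dot u (adjoint A v).
Proof.
have dotE k (x y : 'rV[R]_k) : dot x y = (x *m y^T) 0 0.
  by rewrite mxE; apply: eq_bigr => i _; rewrite mxE.
by rewrite !dotE /adjoint trmx_mul trmxK mulmxA.
Qed.

(* Homology at the middle term of Z^m --A--> Z^n --B--> Z^p, on row vectors *)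

Section Homology.
Variables (m n p : nat) (A : 'M[int]_(m, n)) (B : 'M[int]_(n, p)).

Definition cycle_pred : {pred 'rV[int]_n} := fun c => c *m B == 0.

Fact cycle_pred_zmod_closed : zmod_closed cycle_pred.
Proof.
split=> [|x y]; first by rewrite unfold_in mul0mx.
by rewrite !unfold_in mulmxBl => /eqP -> /eqP ->; rewrite subr0.
Qed.
HB.instance Definition _ :=
  GRing.isZmodClosed.Build _ cycle_pred cycle_pred_zmod_closed.

Record int_cycle := IntCycle {int_cycle_val :> 'rV[int]_n; _ : int_cycle_val \in cycle_pred}.
HB.instance Definition _ := [isSub for int_cycle_val].
HB.instance Definition _ := [Choice of int_cycle by <:].
HB.instance Definition _ := [SubChoice_isSubZmodule of int_cycle by <:].

Definition boundary_pred : {pred int_cycle} :=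
  fun z => `[< exists y : 'rV[int]_m, val z = y *m A >].

Fact boundary_pred_zmod_closed : zmod_closed boundary_pred.
Proof.
split=> [|x y]; first by apply/asboolP; exists 0; rewrite mul0mx raddf0.
move=> /asboolP[a Ha] /asboolP[b Hb]; apply/asboolP; exists (a - b).
by rewrite mulmxBl raddfB /= -Ha -Hb.
Qed.
HB.instance Definition _ :=
  GRing.isZmodClosed.Build _ boundary_pred boundary_pred_zmod_closed.

Definition homology : zmodType := Quotient.quot boundary_pred.

Definition torsion_subgroup : set homology :=
  [set h | exists2 k, (0 < k)%N & h *+ k = 0].

(* fset_set sends infinite sets to the empty one; the torsion subgroup of the
   finitely generated group [homology] is finite. *)
Definition torsion_order : nat := #|` fset_set torsion_subgroup|.

End Homology.

Section Cubes.
Variable R : realType.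

Definition unit_cube n : set 'rV[R]_n := [set x | forall i, 0 <= x 0 i <= 1].
Arguments unit_cube : clear implicits.

Definition in_interior n (t : unit_cube n) : Prop := forall i, 0 < val t 0 i < 1.

Definition face_row n (i : 'I_n.+1) (e : bool) (x : 'rV[R]_n) : 'rV[R]_n.+1 :=
  \row_j oapp (x 0) e%:R (unlift i j).

Fact face_row_subproof n i e (t : unit_cube n) :
  face_row i e (val t) \in unit_cube n.+1.
Proof.
apply/mem_set => j; rewrite mxE; case: unliftP => [k _|_] /=.
  by have /set_mem := valP t; exact.
by case: e; rewrite ?ler01 ?lexx.
Qed.

Definition face n (i : 'I_n.+1) (e : bool) (t : unit_cube n) : unit_cube n.+1 :=
  SigSub (face_row_subproof i e t).

Variable X : topologicalType.

Definition singular_cube n (A : set X) (s : unit_cube n -> X) : Prop :=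
  continuous s /\ range s `<=` A.

(* s factors through the projection forgetting some coordinate. *)
Definition degenerate n (s : unit_cube n -> X) : Prop :=
  exists i : 'I_n, forall t u : unit_cube n,
    (forall j, j != i -> val t 0 j = val u 0 j) -> s t = s u.

(* The free abelian group on all maps from the cube to X; only continuous maps
   are used below. *)
Definition cube_chains n := {freeg (unit_cube n -> X) / int}.

Definition gen n (s : unit_cube n -> X) : cube_chains n := << s >>.

Definition cube_boundary n (s : unit_cube n.+1 -> X) : cube_chains n :=
  \sum_(i < n.+1) (gen (s \o face i true) - gen (s \o face i false)) *~ (-1) ^+ i.

(* The chains in A whose class modulo chains in B, boundaries of chains in A
   and degenerate chains is 0: for B `<=` A, two relative n-cycles of (A, B)
   have the same class in the singular homology group H_n(A, B; Z) iff their
   difference is in this subgroup. *)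
Definition null_chains n (A B : set X) : set (cube_chains n) :=
  zspan ([set gen s | s in @singular_cube n B] `|`
         [set cube_boundary s | s in @singular_cube n.+1 A] `|`
         [set gen s | s in @singular_cube n A `&` @degenerate n]).

End Cubes.

(* The cube [0, 1]^n stands for the closed n-ball. A characteristic map also
   fixes the orientation of its cell, through the standard orientation of the
   cube. As X is Hausdorff and there are finitely many cells, the weak topology
   condition is automatic, and so is the fact that a characteristic map is a
   homeomorphism from the open cube onto its image. *)
Record finiteCW (R : realType) := FiniteCW {
  space :> topologicalType;
  space_hausdorff : hausdorff_space space;
  ncell : nat -> nat;
  ncell_finite : exists N, forall n, (N <= n)%N -> ncell n = 0%N;
  charmap : forall n, 'I_(ncell n) -> @unit_cube R n -> space;
  charmap_continuous : forall n a, continuous (@charmap n a);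
  charmap_inj : forall n a (t u : @unit_cube R n), in_interior t -> in_interior u ->
    @charmap n a t = @charmap n a u -> t = u;
  open_cell_partition : forall x : space, exists! c : {n & 'I_(ncell n)},
    exists2 t : @unit_cube R (tag c), in_interior t & charmap (tagged c) t = x;
  charmap_boundary : forall n a (t : @unit_cube R n), ~ in_interior t ->
    exists m (b : 'I_(ncell m)) (u : @unit_cube R m),
      [/\ (m < n)%N, in_interior u & charmap a t = charmap b u] }.

Arguments ncell {R} X n : rename.
Arguments charmap {R} X {n} a t : rename.

Section Cellular.
Variable R : realType.

(* skeleton_lt X n is the (n-1)-skeleton, empty for n = 0. *)
Definition skeleton_lt (X : finiteCW R) n : set X :=
  [set x | exists m (a : 'I_(ncell X m)) (t : @unit_cube R m),
     (m < n)%N /\ charmap X a t = x].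
Arguments skeleton_lt : clear implicits.

(* The cellular chain complex of X, on the bases of oriented cells. The group
   H_n(X^n, X^(n-1)) is free on the classes of the characteristic maps of the
   n-cells, and incidenceP says that the row of index a of incidence n lists the
   coordinates of the image of the (n+1)-cell a under
     H_(n+1)(X^(n+1), X^n) -> H_n(X^n) -> H_n(X^n, X^(n-1)).
   Hence X has exactly one cellular chain complex: incidenceP determines the
   matrices, and incidence_mul0 is a consequence of it. This consequence is part
   of the structure because it rests on the independence of these classes, which
   needs singular homology theory. *)
Record cellular_complex (X : finiteCW R) := CellularComplex {
  incidence : forall n, 'M[int]_(ncell X n.+1, ncell X n);
  incidenceP : forall n (a : 'I_(ncell X n.+1)),
    null_chains (skeleton_lt X n.+1) (skeleton_lt X n)
      (cube_boundary (charmap X a)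
         - \sum_(b < ncell X n) gen (charmap X b) *~ incidence n a b);
  incidence_mul0 : forall n, incidence n.+1 *m incidence n = 0 }.

Variables (X : finiteCW R) (C : cellular_complex X).

Definition bd d : 'M[int]_(ncell X d, ncell X d.-1) :=
  if d is d'.+1 then incidence C d' else 0.

Definition bdR d : 'M[R]_(ncell X d, ncell X d.-1) := map_mx intr (bd d).

Definition cyclesZ d : set 'rV[R]_(ncell X d) :=
  [set map_mx intr c | c in [set c : 'rV[int]_(ncell X d) | c *m bd d = 0]].

Definition boundariesZ d : set 'rV[R]_(ncell X d) :=
  [set map_mx intr (c *m bd d.+1) | c in [set: 'rV[int]_(ncell X d.+1)]].

Definition harmonics d : set 'rV[R]_(ncell X d) :=
  [set c | c *m bdR d = 0 /\ adjoint (bdR d.+1) c = 0].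

Definition torsion d : nat := torsion_order (bd d.+1) (bd d).

End Cellular.

Arguments bdR {R X} C d.
Arguments cyclesZ {R X} C d.
Arguments boundariesZ {R X} C d.
Arguments harmonics {R X} C d.

(* Main.v *)
(* Smith normal form, applied first to the boundary map on d-chains and then to
   the matrix of the boundary map on (d+1)-chains in a basis of the integral
   d-cycles, gives a basis (a, b) of the integral d-cycles and nonzero integers
   d_i such that the d_i a_i form a basis of the integral d-boundaries. Hence
   the torsion of the homology has order prod |d_i|, and the squared covolume of
   the integral boundaries is (prod d_i)^2 det (gram a). The harmonic projection
   kills a and sends b to its component c orthogonal to a, and
   det (gram (a, b)) = det (gram a) det (gram c). *)
Require Import Defs.
From mathcomp Require Import all_boot all_order all_algebra.
From mathcomp Require Import finmap.
From mathcomp Require Import all_classical all_reals.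
From mathcomp Require Import topology normedtype.
From mathcomp Require Import ring.
Set Implicit Arguments.
Unset Strict Implicit.
Unset Printing Implicit Defensive.
Import Order.TTheory GRing.Theory Num.Theory.
Import numFieldNormedType.Exports.
Local Open Scope quotient_scope.
Local Open Scope classical_set_scope.
Local Open Scope ring_scope.

(** * Smith normal form and a cycle basis adapted to the boundaries *)

(** Each diagonal entry of the Smith form divides the later ones, so everything after the first zero
    vanishes and the nonzero entries fill a leading block. *)
Lemma int_Smith_block m n (A : 'M[int]_(m, n)) :
  exists r s t (d : 'rV[int]_r) (L : 'M[int]_(m, r + s)) (L' : 'M_(r + s, m))
    (Q : 'M[int]_(r + t, n)) (Q' : 'M_(n, r + t)),
  [/\ forall i, d 0 i != 0,
      L *m L' = 1%:M /\ L' *m L = 1%:M,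
      Q *m Q' = 1%:M /\ Q' *m Q = 1%:M
    & A = L *m block_mx (diag_mx d) 0 0 0 *m Q].
Proof.
have [L uL [Q uQ [d sd ->]]] := int_Smith_normal_form A.
(* [find] returns the index of the first zero, or the size of [d] if there is none; the minimum
   keeps the block inside the matrix. *)
pose r := minn (find (pred1 (0 : int)) d) (minn m n).
have nz i : (i < r)%N -> d`_i != 0.
  rewrite leq_min => /andP[lt_i _].
  by have /= -> := before_find 0 lt_i.
have z i : (r <= i)%N -> (i < m)%N -> (i < n)%N -> d`_i = 0.
  move=> le_ri lt_im lt_in.
  have {le_ri} : (find (pred1 (0 : int)) d <= i)%N.
    move: le_ri; rewrite geq_min => /orP[//|].
    by rewrite leqNgt leq_min lt_im lt_in.
  have [le_di _|lt_id le_fi] := leqP (size d) i; first by rewrite nth_default.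
  have hf : has (pred1 (0 : int)) d by rewrite has_find (leq_ltn_trans le_fi).
  have /eqP f0 := nth_find 0 hf.
  have := sorted_leq_nth dvdz_trans dvdzz 0 sd.
  move=> /(_ (find (pred1 (0 : int)) d) i); rewrite !inE f0 dvd0z => h.
  by apply/eqP/h => //; exact: leq_ltn_trans lt_id.
have [s em] : exists s, m = (r + s)%N.
  by exists (m - r)%N; rewrite subnKC // /r minnC -minnA geq_minl.
have [t en] : exists t, n = (r + t)%N.
  by exists (n - r)%N; rewrite subnKC // /r minnA geq_minr.
move: r nz z em en => r nz z em en; subst m n.
exists r, s, t, (\row_i d`_i), L, (invmx L), Q, (invmx Q); split.
- by move=> i; rewrite mxE nz.
- by rewrite mulmxV ?mulVmx.
- by rewrite mulmxV ?mulVmx.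
congr (_ *m _ *m _); apply/matrixP=> i j; rewrite mxE.
case: (split_ordP i) => i' ->; case: (split_ordP j) => j' ->;
  rewrite ?block_mxEul ?block_mxEur ?block_mxEdl ?block_mxEdr !mxE /=.
- by [].
- by case: (i' =P (r + j')%N :> nat) => // e; have := ltn_ord i'; rewrite e ltnNge leq_addr.
- by case: ((r + i')%N =P j' :> nat) => // e; have := ltn_ord j'; rewrite -e ltnNge leq_addr.
- case: ((r + i')%N =P (r + j')%N :> nat) => [e|]; last by rewrite mulr0n.
  by rewrite z ?mul0rn ?leq_addr ?ltn_add2l ?ltn_ord //; move: e => /addnI ->.
Qed.

(* The kernel condition holds over every numDomainType because it is used for
   integral cycles as well as for real ones. *)
Lemma adapted_cycle_basis m n p (A : 'M[int]_(m, n)) (B : 'M[int]_(n, p)) :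
    A *m B = 0 ->
  exists k h (d : 'rV[int]_k) (K : 'M[int]_(k + h, n)) (M : 'M[int]_(n, k + h))
    (P : 'M[int]_(m, k)) (U : 'M[int]_(k, m)),
  [/\ forall i, d 0 i != 0, K *m M = 1%:M /\ K *m B = 0, U *m P = 1%:M,
      A = P *m diag_mx d *m usubmx K
    & forall (S : numDomainType) q (c : 'M[S]_(q, n)),
        c *m map_mx intr B = 0 -> c = c *m map_mx intr M *m map_mx intr K].
Proof.
move=> AB0.
have [r [s [t [e [L [L' [Q [Q' [e0 [LL' L'L] [QQ' _] defB]]]]]]]]] := int_Smith_block B.
(* [c *m B = 0] means that the first [r] entries of [c *m L] vanish. So the last rows of [L'] form a
   basis of the cycles, and the last columns of [L] compute coordinates in it. *)
pose M0 := rsubmx L; pose K0 := dsubmx L'.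
have K0M0 : K0 *m M0 = 1%:M.
  move: L'L; rewrite -{1}[L]hsubmxK -{1}[L']vsubmxK mul_col_row scalar_mx_block.
  by case/eq_block_mx.
have K0B : K0 *m B = 0.
  have -> : K0 = row_mx 0 1%:M *m L'.
    by rewrite -{1}[L']vsubmxK mul_row_col mul0mx mul1mx add0r.
  rewrite defB -!mulmxA (mulmxA L') L'L mul1mx mulmxA mul_row_block.
  rewrite -[RHS](mul0mx _ Q); congr (_ *m _); rewrite -[RHS]row_mx0.
  by rewrite !mul0mx !mulmx0 !addr0.
have ker (S : numDomainType) q (c : 'M[S]_(q, n)) :
    c *m map_mx intr B = 0 -> c = c *m map_mx intr M0 *m map_mx intr K0.
  move=> cB0; have cL : c *m map_mx intr (lsubmx L) = 0.
    have : c *m map_mx intr (B *m Q') = 0.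
      by rewrite map_mxM mulmxA cB0 mul0mx.
    rewrite defB -!mulmxA QQ' mulmx1 -{1}[L]hsubmxK mul_row_block !mulmx0 !addr0.
    rewrite map_row_mx mul_mx_row -[RHS]row_mx0 => /eq_row_mx[+ _].
    rewrite map_mxM mulmxA map_diag_mx mul_mx_diag => /matrixP cLe.
    apply/matrixP => i j; have /eqP := cLe i j.
    by rewrite !mxE mulf_eq0 intr_eq0 (negPf (e0 j)) orbF => /eqP.
  rewrite -mulmxA -map_mxM -[LHS]mulmx1 -(map_mx1 intr) -LL'.
  rewrite -{1}[L]hsubmxK -{1}[L']vsubmxK mul_row_col map_mxD mulmxDr.
  by rewrite [X in _ *m X + _]map_mxM mulmxA cL mul0mx add0r.
(* [A *m M0] is the boundary matrix in cycle coordinates. Its Smith form turns [K0] into the basis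
   [Q1 *m K0], whose first [k] rows, scaled by [d], generate the boundaries. *)
have [k [l [h [d [P [P' [Q1 [Q1' [d0 [_ P'P] [QQ1 Q1Q] defAM]]]]]]]]] :=
  int_Smith_block (A *m M0).
have intr_id a b (X : 'M[int]_(a, b)) : map_mx intr X = X.
  by apply/matrixP => i j; rewrite mxE intz.
have defA : A = A *m M0 *m K0.
  by have := ker _ _ A; rewrite !intr_id => -> //; rewrite -!mulmxA (mulmxA K0) K0M0 mul1mx.
exists k, h, d, (Q1 *m K0), (M0 *m Q1'), (lsubmx P), (usubmx P'); split=> //.
- by rewrite -mulmxA (mulmxA K0) K0M0 mul1mx QQ1 -mulmxA K0B mulmx0.
- move: P'P; rewrite -{1}[P]hsubmxK -{1}[P']vsubmxK mul_col_row scalar_mx_block.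
  by case/eq_block_mx.
- rewrite defA defAM -{1}[P]hsubmxK mul_row_block !mulmx0 !addr0.
  by rewrite -[Q1]vsubmxK mul_row_col mul0mx addr0 mul_col_mx col_mxKu mulmxA.
- move=> S q c cB0; rewrite {1}(ker S q c cB0) !map_mxM !mulmxA.
  by rewrite -(mulmxA _ (map_mx _ Q1')) -map_mxM Q1Q map_mx1 mulmx1.
Qed.

(** * Order of the torsion subgroup of homology *)

(** By [U *m P = 1%:M], every integral row of length [k] has the form [w *m P]; so the boundaries
    are all integral combinations of the rows of [usubmx K] scaled by [d]. *)
Lemma boundary_coordP m n k h (A : 'M[int]_(m, n)) (d : 'rV[int]_k)
    (K : 'M[int]_(k + h, n)) (M : 'M[int]_(n, k + h))
    (P : 'M[int]_(m, k)) (U : 'M[int]_(k, m)) (y : 'rV[int]_(k + h)) :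
    K *m M = 1%:M -> U *m P = 1%:M -> A = P *m diag_mx d *m usubmx K ->
  (exists w : 'rV_m, y *m K = w *m A) <->
  (forall i, (d 0%R i %| y 0%R (lshift h i))%Z) /\ rsubmx y = 0.
Proof.
move=> KM UP defA; split=> [[w ywA]|[dvd_y y0]].
  have KaM : usubmx K *m M = row_mx 1%:M 0.
    by rewrite mul_usub_mx KM scalar_mx_block /block_mx col_mxKu.
  have -> : y = row_mx (w *m P *m diag_mx d) 0.
    rewrite -[LHS]mulmx1 -KM mulmxA ywA defA !mulmxA -(mulmxA _ _ M) KaM.
    by rewrite mul_mx_row mulmx1 mulmx0.
  split=> [i|]; last by rewrite row_mxKr.
  by rewrite row_mxEl mul_mx_diag mxE dvdz_mull.
exists ((\row_i (y 0%R (lshift h i) %/ d 0%R i)%Z) *m U).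
rewrite defA -!mulmxA (mulmxA U) UP mul1mx !mulmxA.
rewrite -{1}[K]vsubmxK -[y in LHS]hsubmxK mul_row_col y0 mul0mx addr0.
congr (_ *m _); apply/rowP => i; rewrite mul_mx_diag !mxE divzK //.
Qed.

Lemma homology_class_eq0 m n p (A : 'M[int]_(m, n)) (B : 'M[int]_(n, p))
    (z : int_cycle B) :
  \pi_(homology A B) z = 0 <-> exists w : 'rV_m, val z = w *m A.
Proof.
have <- : z \in boundary_pred A (B := B) <-> exists w : 'rV_m, val z = w *m A.
  by split=> /asboolP.
rewrite -[z in X in _ <-> X]subr0 Quotient.idealrBE.
rewrite -[0 in X in X <-> _](raddf0 (\pi_(homology A B))).
by split=> [->|/eqP].
Qed.

(** In the adapted basis homology is the sum of the groups Z/d_i and of Z^h. Each torsion class has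
    exactly one representative whose first coordinates are residues below |d_i| and whose last ones
    are zero; these are counted. *)
Lemma torsion_order_prod m n p k h (A : 'M[int]_(m, n)) (B : 'M[int]_(n, p))
    (d : 'rV[int]_k) (K : 'M[int]_(k + h, n)) (M : 'M[int]_(n, k + h))
    (P : 'M[int]_(m, k)) (U : 'M[int]_(k, m)) :
    (forall i, d 0 i != 0) -> K *m M = 1%:M -> K *m B = 0 -> U *m P = 1%:M ->
    A = P *m diag_mx d *m usubmx K ->
    (forall c : 'rV_n, c *m B = 0 -> c = c *m M *m K) ->
  torsion_order A B = (\prod_i `|d 0%R i|)%N.
Proof.
move=> d0 KM KB UP defA ker.
have cycK (y : 'rV_(k + h)) : y *m K \in cycle_pred B.
  by apply/eqP; rewrite -mulmxA KB mulmx0.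
pose cl y : homology A B := \pi_(homology A B) (IntCycle (cycK y)).
have clP y : cl y = 0 <-> (forall i, (d 0%R i %| y 0%R (lshift h i))%Z) /\ rsubmx y = 0.
  rewrite homology_class_eq0 /=; exact: (boundary_coordP _ KM UP defA).
have clB (x y : 'rV_(k + h)) : cl (x - y) = cl x - cl y.
  rewrite /cl -raddfB; apply: (congr1 \pi_(homology A B)); apply/val_inj => /=.
  by rewrite mulmxBl.
have clMn (x : 'rV_(k + h)) q : cl (x *+ q) = cl x *+ q.
  rewrite /cl -raddfMn. apply: (congr1 \pi_(homology A B)); apply/val_inj => /=.
  by rewrite [RHS](raddfMn (\val : int_cycle B -> _)); exact: (raddfMn (mulmxr K)).
have cl_surj c : exists y, c = cl y.
  exists (val (repr c) *m M); rewrite -[c in LHS]reprK; apply: (congr1 \pi_(homology A B)).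
  apply/val_inj => /=; apply: ker.
  by have := valP (repr c) => /eqP.
pose T := {dffun forall i : 'I_k, 'I_(absz (d 0%R i))}.
pose crd (t : T) : 'rV[int]_(k + h) := row_mx (\row_i (t i : nat)%:Z) 0.
have inj : injective (cl \o crd).
  move=> t u /= /eqP; rewrite -subr_eq0 -clB => /eqP /clP[dv _].
  apply/ffunP => i; apply/val_inj => /=.
  have := dv i; rewrite !mxE !(unsplitK (inl i)) !mxE -eqz_mod_dvd.
  have lt (v : T) : ((v i : nat)%:Z < `|d 0 i|)%R by rewrite -abszE ltz_nat.
  by rewrite -[(_ %% _)%Z]modz_abs -[RHS in _ == RHS]modz_abs !modz_small ?lt // => /eqP[].
have -> : torsion_order A B = #|T|.
  rewrite /torsion_order.
  have -> : torsion_subgroup (A := A) (B := B) = [set` [fset cl (crd t) | t in T]%fset].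
    apply/seteqP; split=> [c [q q0]|c /imfsetP[t _ ->]] /=.
      have [y ->] := cl_surj c; rewrite -clMn => /clP[_ yq0].
      (* The last [h] coordinates live in a torsion-free group, hence vanish; the first ones are
         then reduced modulo [d]. *)
      have y0 : rsubmx y = 0.
        apply/rowP => i; move/rowP: yq0 => /(_ i) /eqP.
        by rewrite !mxE mulmxnE mulrn_eq0 eqn0Ngt q0 => /eqP.
      have lt i : (`|(y 0%R (lshift h i) %% d 0%R i)%Z| < `|d 0%R i|)%N.
        by rewrite -ltz_nat !abszE ger0_norm ?modz_ge0 ?ltz_mod.
      apply/imfsetP; exists [ffun i => Ordinal (lt i)] => //.
      apply/eqP; rewrite -subr_eq0 -clB; apply/eqP/clP; split=> [i|].
        rewrite !mxE (unsplitK (inl i)) mxE ffunE /= abszE ger0_norm ?modz_ge0 //.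
        by rewrite -eqz_mod_dvd modz_mod.
      by rewrite raddfB /= y0 row_mxKr subrr.
    (* This product is a positive common multiple of the d_i, so it kills every class
       [cl (crd t)]. *)
    exists (\prod_i `|d 0%R i|)%N; first by rewrite prodn_gt0 // => i; rewrite absz_gt0.
    rewrite -clMn; apply/clP; split=> [i|].
      rewrite mulmxnE -mulr_natr dvdz_mull // natz dvdzE /= (bigD1 i) //=.
      by rewrite dvdn_mulr.
    by rewrite raddfMn /= row_mxKr mul0rn.
  by rewrite set_fsetK card_imfset //= -cardE.
rewrite card_dep_ffun /image_mem.
rewrite -[RHS]big_enum /=.
by elim: (enum _) => [|i s IH] /=; rewrite ?big_nil // big_cons IH card_ord.
Qed.

(** * Gram matrices and their determinants *)

Lemma dot_mul (R : realType) n (u v : 'rV[R]_n) : dot u v = (u *m v^T) 0 0.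
Proof. by rewrite mxE; apply: eq_bigr => i _; rewrite mxE. Qed.

Lemma dotvv_eq0 (R : realType) n (v : 'rV[R]_n) : dot v v = 0 -> v = 0.
Proof.
move=> /eqP; rewrite psumr_eq0 => [/allP vv0|i _]; last by rewrite -expr2 sqr_ge0.
apply/rowP => i; rewrite mxE; apply/eqP.
by have := vv0 i; rewrite mem_index_enum mulf_eq0 orbb; exact.
Qed.

Lemma gramE (R : realType) n r (b : 'M[R]_(r, n)) : gram b = b *m b^T.
Proof.
by apply/matrixP => i j; rewrite !mxE; apply: eq_bigr => k _; rewrite !mxE.
Qed.

Lemma gram_mul (R : realType) n q r (u : 'M[R]_(q, r)) (b : 'M[R]_(r, n)) :
  gram (u *m b) = u *m gram b *m u^T.
Proof. by rewrite !gramE trmx_mul !mulmxA. Qed.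

(** If [v] kills the Gram matrix, then [v *m b] has norm zero, and the right inverse of [b] gives
    [v = 0]. *)
Lemma gram_unitmx (R : realType) n r (b : 'M[R]_(r, n)) (c : 'M[R]_(n, r)) :
  b *m c = 1%:M -> gram b \in unitmx.
Proof.
move=> bc; rewrite -row_free_unit -kermx_eq0; apply/rowV0P => v /sub_kermxP.
rewrite gramE mulmxA => vG; have /dotvv_eq0 vb0 : dot (v *m b) (v *m b) = 0.
  by rewrite dot_mul trmx_mul mulmxA vG mul0mx mxE.
by rewrite -[v]mulmx1 -bc mulmxA vb0 mul0mx.
Qed.

(** Subtracting [t *m a] from [b] is a unipotent change of rows; afterwards the two blocks are
    orthogonal and the Gram matrix is block diagonal. *)
Lemma det_gram_col_mx (R : realType) n k h (a : 'M[R]_(k, n)) (b : 'M[R]_(h, n))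
    (t : 'M[R]_(h, k)) : (b - t *m a) *m a^T = 0 ->
  \det (gram (col_mx a b)) = \det (gram a) * \det (gram (b - t *m a)).
Proof.
set c := b - _ => ca0.
have -> : col_mx a b = block_mx 1%:M 0 t 1%:M *m col_mx a c.
  by rewrite mul_block_col !mul1mx mul0mx addr0 /c addrC subrK.
rewrite gram_mul !det_mulmx det_tr det_lblock !det1 mul1r mulr1 mul1r.
rewrite !gramE tr_col_mx mul_col_row ca0.
have -> : a *m c^T = 0 by rewrite -[LHS]trmxK trmx_mul trmxK ca0 trmx0.
by rewrite det_ublock.
Qed.

(** * Integral bases, covolume and discreteness *)

Lemma Zbasis_inj (R : realType) n (L : set 'rV[R]_n) q r (b : 'M[R]_(r, n))
    (u v : 'M[int]_(q, r)) : is_Zbasis L b ->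
  map_mx intr u *m b = map_mx intr v *m b -> u = v.
Proof.
move=> [_ b_inj _] uv; apply/row_matrixP => i.
apply: b_inj; rewrite ?inE //; move/(congr1 (row i)): uv.
by rewrite !row_mul -!map_row.
Qed.

Lemma Zbasis_factor (R : realType) n (L : set 'rV[R]_n) r s (b : 'M[R]_(r, n))
    (c : 'M[R]_(s, n)) : is_Zbasis L b -> is_Zbasis L c ->
  exists u : 'M[int]_(r, s), b = map_mx intr u *m c.
Proof.
move=> [bL _ _] [_ _ c_surj].
have rowb i : exists x : 'rV[int]_s, row i b = map_mx intr x *m c.
  have Lb : L (row i b).
    suff -> : row i b = map_mx intr (delta_mx 0 i : 'rV[int]_r) *m b by exact: bL.
    by rewrite map_delta_mx -rowE.
  by have [x _ <-] := c_surj _ Lb; exists x.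
have [f fE] := choice rowb.
exists (\matrix_i f i); apply/row_matrixP => i.
by rewrite fE row_mul -map_row rowK.
Qed.

(** Two integral bases are related by mutually inverse integral matrices, whose determinants are 1
    or -1, and the determinant enters squared. *)
Lemma covol2_Zbasis (R : realType) n (L : set 'rV[R]_n) r (b : 'M[R]_(r, n)) :
  is_Zbasis L b -> covol2 L = \det (gram b).
Proof.
move=> Lb; apply: xget_unique; first by exists r, b.
move=> _ [s [c [Lc ->]]].
have [u defb] := Zbasis_factor Lb Lc; have [v defc] := Zbasis_factor Lc Lb.
have uv : u *m v = 1%:M.
  by apply: (Zbasis_inj Lb); rewrite map_mxM -mulmxA -defc -defb map_mx1 mul1mx.
have vu : v *m u = 1%:M.
  by apply: (Zbasis_inj Lc); rewrite map_mxM -mulmxA -defb -defc map_mx1 mul1mx.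
have ers : r = s by apply/eqP; rewrite eqn_leq (mulmx1_min uv) (mulmx1_min vu).
subst s; rewrite defb gram_mul !det_mulmx det_tr mulrAC -expr2.
suff -> : \det (map_mx intr u) ^+ 2 = 1 :> R by rewrite mul1r.
rewrite det_map_mx -rmorphXn /=.
have : \det u \is a GRing.unit by rewrite -unitmxE; case/mulmx1_unit: uv.
by rewrite qualifE /= => /orP[] /eqP ->; rewrite ?sqrrN expr1n.
Qed.

(** The right inverse [c] serves as a certificate of linear independence. *)
Lemma free_Zbasis (R : realType) n r (b : 'M[R]_(r, n)) (c : 'M[R]_(n, r)) :
  b *m c = 1%:M ->
  is_Zbasis [set map_mx intr x *m b | x in [set: 'rV[int]_r]] b.
Proof.
move=> bc; split=> [x _|x y _ _ /(congr1 (mulmxr c))|_ [x _ <-]].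
- by exists x.
- rewrite /= -!mulmxA bc !mulmx1; move=> xy; apply/rowP => i; apply: intr_inj.
  by move/rowP: xy => /(_ i); rewrite !mxE; exact.
- by exists x.
Qed.

(** Multiplication by [c] recovers integral coordinates from lattice points, so close points have
    coordinates differing by less than 1, hence equal. *)
Lemma free_discrete (R : realType) n r (b : 'M[R]_(r, n)) (c : 'M[R]_(n, r)) :
  b *m c = 1%:M ->
  discrete_set [set map_mx intr x *m b | x in [set: 'rV[int]_r]].
Proof.
move=> bc _ [x _ <-]; split; first by apply/mem_set; exists x.
(* [s] bounds the column sums of |c|; the radius 1/(1 + s) makes sense even for [c = 0] and keeps
   the coordinate differences strictly below 1. *)
pose s : R := \sum_i \sum_j `|c j i|.
have s0 : 0 <= s by apply: sumr_ge0 => i _; apply: sumr_ge0.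
have s1 : 0 < 1 + s by rewrite ltr_wpDr.
have e0 : 0 < (1 + s)^-1 by rewrite invr_gt0.
exists (ball (map_mx intr x *m b) (1 + s)^-1); first exact: nbhsx_ballx.
apply/seteqP; split=> [z [/= xz [y _ defz]]|_ ->]; last first.
  by split; [exact: ballxx | exists x].
move: xz; rewrite -defz => -[_ xy]; congr (map_mx _ _ *m _); apply/rowP => i; apply/eqP.
rewrite eq_sym -subr_eq0 -absz_eq0.
pose v : 'rV[R]_n := map_mx intr x *m b - map_mx intr y *m b.
have vc : (x 0 i - y 0 i)%:~R = \sum_j v 0 j * c j i.
  have <- : (v *m c) 0 i = \sum_j v 0 j * c j i by rewrite mxE.
  by rewrite mulmxBl -!mulmxA bc !mulmx1 !mxE rmorphB.
have : `|(x 0 i - y 0 i)%:~R| < 1 :> R.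
  rewrite vc; apply: (@le_lt_trans _ _ ((1 + s)^-1 * s)); last first.
    by rewrite mulrC ltr_pdivrMr // mul1r ltrDr.
  apply: (le_trans (ler_norm_sum _ _ _)).
  have s_i : \sum_j `|c j i| <= s.
    by rewrite /s (bigD1 i) //= lerDl sumr_ge0 // => k _; rewrite sumr_ge0.
  apply: le_trans (ler_wpM2l (ltW e0) s_i).
  rewrite mulr_sumr; apply: ler_sum => j _.
  rewrite normrM ler_wpM2r // ltW //; have := xy 0 j.
  by rewrite /ball /= !mxE.
by rewrite -intr_norm ltrz1 -abszE ltz_nat ltnS leqn0.
Qed.

(** * Harmonic projection of the integral cycles *)

Lemma dotBl (R : realType) n (u v w : 'rV[R]_n) :
  dot (u - v) w = dot u w - dot v w.
Proof.
by rewrite /dot -sumrB; apply: eq_bigr => i _; rewrite !mxE mulrBl.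
Qed.

(** The difference of two candidates lies in [V] and is orthogonal to [V], hence to itself, so
    [xget] can only pick [h]. *)
Lemma orthprojE (R : realType) n (V : set 'rV[R]_n) (v h : 'rV[R]_n) :
    (forall x y, V x -> V y -> V (x - y)) ->
    V h -> (forall w, V w -> dot (v - h) w = 0) ->
  orthproj V v = h.
Proof.
move=> VB Vh vh; apply: xget_unique => // g [Vg vg].
have Vgh := VB _ _ Vg Vh; apply/eqP; rewrite -subr_eq0; apply/eqP/dotvv_eq0.
have {1}-> : g - h = (v - h) - (v - g) by rewrite opprB [RHS]addrC addrA subrK.
by rewrite dotBl vh // vg // subrr.
Qed.

(** The theorem in terms of two integral matrices with zero product, free of cells. *)
Lemma lattice_harmonics_covol2 (R : realType) m n p
    (A : 'M[int]_(m, n)) (B : 'M[int]_(n, p)) (AB0 : A *m B = 0)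
    (H := [set c : 'rV[R]_n |
      c *m map_mx intr B = 0 /\ adjoint (map_mx intr A) c = 0])
    (Z := [set (map_mx intr c : 'rV[R]_n) | c in [set c : 'rV[int]_n | c *m B = 0]]) :
  is_lattice H (orthproj H @` Z) /\
  covol2 (orthproj H @` Z) =
    covol2 Z / covol2 [set (map_mx intr (c *m A) : 'rV[R]_n) | c in [set: 'rV[int]_m]]
      * (torsion_order A B)%:R ^+ 2.
Proof.
have [k [h [d [K [M [P [U [d0 [KM KB] UP defA ker]]]]]]]] := adapted_cycle_basis AB0.
have intr_id a b (X : 'M[int]_(a, b)) : map_mx intr X = X.
  by apply/matrixP => i j; rewrite mxE intz.
have kerZ (c : 'rV[int]_n) : c *m B = 0 -> c = c *m M *m K.
  by have := ker _ _ c; rewrite !intr_id.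
rewrite (torsion_order_prod d0 KM KB UP defA kerZ).
pose rl s t (X : 'M[int]_(s, t)) : 'M[R]_(s, t) := map_mx intr X.
pose a := usubmx (rl _ _ K); pose b := dsubmx (rl _ _ K).
pose ma := lsubmx (rl _ _ M); pose mb := rsubmx (rl _ _ M).
have KMr : rl _ _ K *m rl _ _ M = 1%:M by rewrite -map_mxM KM map_mx1.
have [ama amb bma bmb] : [/\ a *m ma = 1%:M, a *m mb = 0, b *m ma = 0 & b *m mb = 1%:M].
  move: KMr; rewrite -{1}[rl _ _ K]vsubmxK -{1}[rl _ _ M]hsubmxK mul_col_row.
  by rewrite scalar_mx_block => /eq_block_mx[].
have defK : rl _ _ K = col_mx a b by rewrite vsubmxK.
have uG := gram_unitmx ama.
(* The normal equations: [t *m a] is the orthogonal projection of the rows of [b] to the span of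
   those of [a]. *)
pose t := b *m a^T *m invmx (gram a); pose c := b - t *m a.
have ca0 : c *m a^T = 0.
  by rewrite mulmxBl -(mulmxA t) -gramE mulmxKV ?subrr.
(* [mb] kills [a], so it stays a right inverse when [b] is replaced by [c]. *)
have cmb : c *m mb = 1%:M by rewrite mulmxBl bmb -mulmxA amb mulmx0 subr0.
have defAr : rl _ _ A = rl _ _ P *m diag_mx (rl _ _ d) *m a.
  by rewrite /a /rl -map_usubmx -map_diag_mx -!map_mxM -defA.
have UPr : rl _ _ U *m rl _ _ P = 1%:M by rewrite -map_mxM UP map_mx1.
have KBr : rl _ _ K *m rl _ _ B = 0 by rewrite -map_mxM KB map_mx0.
(* The factors [P] and [d] of [A] cancel from the adjoint condition, since [P] has a left inverse
   and no d_i is zero. *)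
have HE : H = [set x | x *m rl _ _ B = 0 /\ x *m a^T = 0].
  apply/seteqP; split=> x /= [xB xA]; split=> //.
    move: xA; rewrite /adjoint -/(rl _ _ A) defAr !trmx_mul tr_diag_mx !mulmxA.
    move/(congr1 (mulmx^~ (rl _ _ U)^T)).
    rewrite mul0mx -(mulmxA _ _ (rl _ _ U)^T) -trmx_mul UPr trmx1 mulmx1.
    rewrite mul_mx_diag => /rowP xad; apply/rowP => i; have /eqP := xad i.
    by rewrite !mxE mulf_eq0 intr_eq0 (negPf (d0 i)) orbF => /eqP.
  by rewrite /adjoint -/(rl _ _ A) defAr !trmx_mul !mulmxA xA !mul0mx.
have HB x y : H x -> H y -> H (x - y).
  by rewrite HE => -[xB xa] [yB ya]; split; rewrite mulmxBl ?xB ?xa ?yB ?ya subrr.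
have aB : a *m rl _ _ B = 0.
  by rewrite mul_usub_mx KBr; apply/matrixP => i j; rewrite !mxE.
have bB : b *m rl _ _ B = 0.
  by rewrite mul_dsub_mx KBr; apply/matrixP => i j; rewrite !mxE.
have Hc (y : 'rV_h) : H (y *m c).
  rewrite HE; split; rewrite -mulmxA ?ca0 ?mulmx0 //.
  by rewrite mulmxBl bB -mulmxA aB mulmx0 subrr mulmx0.
(* With y = (y1, y2), the cycle is (y1 + y2 t) a + y2 c: the first term is orthogonal to [H], the
   second lies in [H]. *)
have projE (y : 'rV[R]_(k + h)) : orthproj H (y *m rl _ _ K) = rsubmx y *m c.
  apply: orthprojE => // w; rewrite HE => -[_ wa].
  have -> : y *m rl _ _ K - rsubmx y *m c = (lsubmx y + rsubmx y *m t) *m a.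
    rewrite defK -{1}[y]hsubmxK mul_row_col mulmxBr mulmxDl mulmxA.
    by rewrite opprB [X in _ + X]addrC addrA addrK.
  by rewrite dot_mul -mulmxA -[a *m _]trmxK trmx_mul trmxK wa trmx0 mulmx0 mxE.
have ZE : Z = [set map_mx intr x *m rl _ _ K | x in [set: 'rV[int]_(k + h)]].
  apply/seteqP; split=> _ [x xB <-]; last first.
    by exists (x *m K); rewrite ?map_mxM //= -mulmxA KB mulmx0.
  by exists (x *m M) => //; rewrite -map_mxM -kerZ.
have projZ : orthproj H @` Z = [set map_mx intr x *m c | x in [set: 'rV[int]_h]].
  rewrite ZE; apply/seteqP; split=> [_ [_ [x _ <-] <-]|_ [x _ <-]].
    by exists (rsubmx x) => //; rewrite projE map_rsubmx.
  exists (map_mx intr (row_mx 0 x) *m rl _ _ K); first by exists (row_mx 0 x).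
  by rewrite projE -map_rsubmx row_mxKr.
have BE : [set (map_mx intr (x *m A) : 'rV[R]_n) | x in [set: 'rV[int]_m]] =
    [set map_mx intr x *m (diag_mx (rl _ _ d) *m a) | x in [set: 'rV[int]_k]].
  apply/seteqP; split=> _ [x _ <-].
    by exists (x *m P) => //; rewrite !map_mxM -/(rl _ _ A) defAr !mulmxA.
  exists (x *m U) => //; rewrite !map_mxM -/(rl _ _ A) defAr !mulmxA.
  by rewrite -(mulmxA _ (rl _ _ U)) UPr mulmx1.
split.
  split.
  - by rewrite projZ => _ [x _ <-].
  - rewrite projZ; split=> [|_ _ [x _ <-] [y _ <-]].
      by exists 0; rewrite // map_mx0 mul0mx.
    by exists (x - y) => //; rewrite map_mxB mulmxBl.
  - by rewrite projZ; exact: free_discrete cmb.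
  (* A harmonic [x] is a real cycle, hence a real combination of the rows of [K]; being its own
     projection, it is a combination of the rows of [c]. *)
  - move=> x; rewrite {1}HE projZ => -[xB xa].
    exists h, (x *m mb), c; split=> [i|].
      by exists (delta_mx 0 i) => //; rewrite map_delta_mx -rowE.
    have := ker _ _ _ xB; rewrite -[RHS]/(x *m rl _ _ M *m rl _ _ K) => defx.
    have Hx : H x by rewrite HE.
    transitivity (orthproj H x).
      by symmetry; apply: (orthprojE HB Hx) => w _; rewrite subrr dot_mul mul0mx mxE.
    rewrite {1}defx projE; congr (_ *m c).
    by rewrite -{1}[rl _ _ M]hsubmxK mul_mx_row row_mxKr.
rewrite projZ (covol2_Zbasis (free_Zbasis cmb)) ZE (covol2_Zbasis (free_Zbasis KMr)) BE.
have dam : diag_mx (rl _ _ d) *m a *m (ma *m diag_mx (map_mx GRing.inv (rl _ _ d))) = 1%:M.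
  rewrite -mulmxA (mulmxA a) ama mul1mx mulmx_diag -diag_const_mx; congr diag_mx.
  by apply/rowP => i; rewrite !mxE divff ?intr_eq0.
rewrite (covol2_Zbasis (free_Zbasis dam)) defK (det_gram_col_mx ca0).
rewrite gram_mul !det_mulmx det_tr det_diag.
have gn0 : \det (gram a) != 0 by rewrite -unitfE -unitmxE.
(* The torsion order involves |d_i| and the covolume d_i; their squares agree. *)
have -> : ((\prod_i `|d 0%R i|)%N%:R : R) ^+ 2 = (\prod_i rl _ _ d 0 i) ^+ 2.
  rewrite natr_prod -!prodrXl; apply: eq_bigr => i _.
  by rewrite mxE natr_absz intr_norm real_normK ?num_real.
have : \prod_i rl _ _ d 0 i != 0.
  by apply/prodf_neq0 => i _; rewrite mxE intr_eq0.
(* Both det(gram a) and D^2 cancel, which leaves det(gram c). *)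
move: (\prod_i _) => D D0; rewrite -/c; field.
by rewrite D0 gn0.
Qed.

Theorem mainTheorem8 (R : realType) (X : finiteCW R) (C : cellular_complex X)
    (d : nat) (hd : (1 <= d)%N) :
  is_lattice (harmonics C d) (orthproj (harmonics C d) @` cyclesZ C d) /\
  covol2 (orthproj (harmonics C d) @` cyclesZ C d) =
    covol2 (cyclesZ C d) / covol2 (boundariesZ C d) * (torsion C d)%:R ^+ 2.
Proof.
have dd0 : bd C d.+1 *m bd C d = 0.
  by case: d {hd} => [|d] /=; [exact: mulmx0 | exact: incidence_mul0].
(* The cellular sets and the torsion order unfold to those attached to the matrices [bd C d.+1] and
   [bd C d]. *)
exact: lattice_harmonics_covol2 dd0.
Qed.
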